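(* Let $G=(V,E,\sigma,o)$ be a proper infinite tree and let $\rho\in\mathbb{R}^E_{\ge0}$. Then $\rho\in\mathrm{Adm}(\Gamma_\infty)$ if and only if $$\sum_{e\in E}\rho(e)\eta(e)\ge1\qquad\text{for all }\eta\in\Lambda.$$
   Context: A rooted tree $G$ has root $o$, edge set $E$. The generation of an edge $e$ is the number of edges on the unique path from $o$ ending with $e$; $S_1$ is the set of edges of generation $1$; $e$ is the parent of $e'$ ($e'\in c(e)$, the set of children of $e$) if they are adjacent and $e'$ has generation one more than $e$. A proper infinite tree is infinite, locally finite, and every edge has at least one child. A descending path is a path $e_1e_2\cdots$ from $o$ with $e_i$ the parent of $e_{i+1}$; $\Gamma_\infty$ is the set of infinite descending paths. For $\rho:E\to[0,\infty)$, $\ell_\rho(\gamma)=\sum_{e\in\gamma}\rho(e)$ and $\mathrm{Adm}(\Gamma_\infty)=\{\rho\ge0:\ell_\rho(\gamma)\ge1\ \forall\gamma\in\Gamma_\infty\}$. Define $$\Lambda=\Big\{\eta\in\mathbb{R}^E_{\ge0}:\sum_{e\in S_1}\eta(e)=1,\ \sum_{e'\in c(e)}\eta(e')=\eta(e)\ \ \forall e\in E\Big\}.$$ *)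

(* Defs.v *)
From HB Require Import structures.
From mathcomp Require Import all_boot all_order all_algebra.
From mathcomp Require Import all_classical all_reals all_analysis.

Set Implicit Arguments.
Unset Strict Implicit.
Unset Printing Implicit Defensive.

Import Order.TTheory GRing.Theory Num.Theory.
Local Open Scope classical_set_scope.
Local Open Scope ring_scope.

(* A simple graph (V, E, sigma, o): no loops, no multiple edges.  The edge
   weights sigma are data only; no sign condition is put on them. *)
Record rooted_graph (R : realType) := RootedGraph {
  vertex : choiceType;
  edge : choiceType;
  ends : edge -> set vertex;
  sigma : edge -> R;
  root : vertex;
  endsP : forall e : edge, exists x y : vertex, x <> y /\ ends e = [set x; y];
  ends_inj : injective ends
}.

Section Graph.
Context {R : realType} (G : rooted_graph R).
Implicit Types (x y : vertex G) (e : edge G) (rho eta : edge G -> R).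

Definition adj : rel (vertex G) :=
  fun x y => `[< exists e, ends e = [set x; y] >].

Definition connected_graph : Prop :=
  forall x y, exists p : seq (vertex G), path adj x p /\ last x p = y.

Definition acyclic_graph : Prop :=
  forall c : seq (vertex G), (2 < size c)%N -> ~ ucycle adj c.

Definition is_tree : Prop := connected_graph /\ acyclic_graph.

Definition locally_finite : Prop :=
  forall x, finite_set [set e | ends e x].

(* A finite path from x is the list of the vertices visited after x, so that
   its size is its number of edges. *)
Definition simple_path x (p : seq (vertex G)) : bool :=
  path adj x p && uniq (x :: p).

Definition path_ends_with e (p : seq (vertex G)) : Prop :=
  exists q y, p = rcons q y /\ ends e = [set last (root G) q; y].

(* In a tree exactly one n has the property; the default 0 is then unused. *)
Definition generation e : nat :=
  xget 0%N [set n | exists p : seq (vertex G),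
    [/\ simple_path (root G) p, path_ends_with e p & n = size p]].

Definition S1 : set (edge G) := [set e | generation e = 1%N].

Definition adjacent_edges e e' : Prop :=
  e <> e' /\ ends e `&` ends e' !=set0.

Definition parent e e' : Prop :=
  adjacent_edges e e' /\ generation e' = (generation e).+1.

Definition children e : set (edge G) := [set e' | parent e e'].

Definition proper_infinite_tree : Prop :=
  [/\ is_tree,
      infinite_set [set: vertex G],
      locally_finite
    & forall e, exists e', children e e'].

(* gamma is indexed from 0: gamma i is the edge e_(i+1). *)
Definition infinite_path_from x (gamma : nat -> edge G) : Prop :=
  exists v : nat -> vertex G,
    [/\ v 0%N = x, injective v
      & forall i, ends (gamma i) = [set v i; v i.+1]].

Definition Gamma_infty : set (nat -> edge G) :=
  [set gamma | infinite_path_from (root G) gamma /\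
               forall i, parent (gamma i) (gamma i.+1)].

Definition path_length rho (gamma : nat -> edge G) : \bar R :=
  (\esum_(e in range gamma) (rho e)%:E)%E.

Definition Adm (Gam : set (nat -> edge G)) : set (edge G -> R) :=
  [set rho | (forall e, 0 <= rho e) /\
             forall gamma, Gam gamma -> (1 <= path_length rho gamma)%E].

(* In a locally finite tree S1 and children e are finite, so the \sum_(_ \in _)
   below are ordinary finite sums. *)
Definition Lambda : set (edge G -> R) :=
  [set eta | [/\ forall e, 0 <= eta e,
                 \sum_(e \in S1) eta e = 1
               & forall e, \sum_(e' \in children e) eta e' = eta e]].

End Graph.

(* Main.v *)
(* If rho is not admissible along a descending path gamma, the indicator of
   gamma lies in Lambda and its rho-weighted sum is the length of gamma.
   Conversely, let eta be in Lambda with total s = \sum rho eta < 1, and let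
   W(e) be the part of this sum carried by e and its descendants.  When
   eta(e) > 0, the ratio W(e) / eta(e) is the expected rho-length of the rest
   of a random descending path starting with e that picks children with
   probabilities proportional to eta.  So some child e' has eta(e') > 0 and
   W(e') / eta(e') <= W(e) / eta(e) - rho(e).  Following such children from a
   suitable edge of S_1 gives a descending path of length at most s. *)
Require Import Defs.
From mathcomp Require Import finmap.
From mathcomp Require Import all_boot all_order all_algebra.
From mathcomp Require Import all_classical all_reals all_analysis.
Import Order.TTheory GRing.Theory Num.Theory.
Local Open Scope classical_set_scope.
Local Open Scope ring_scope.

Lemma set2_eqP {T : Type} {a b c d : T} :
  [set a; b] = [set c; d] -> (a = c /\ b = d) \/ (a = d /\ b = c).
Proof.
move=> E.
have Ha : [set c; d] a by rewrite -E; left.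
have Hb : [set c; d] b by rewrite -E; right.
have Hc : [set a; b] c by rewrite E; left.
have Hd : [set a; b] d by rewrite E; right.
case: Ha => /= Ha; case: Hb => /= Hb; subst; auto.
  by case: Hd => /= <-; auto.
by case: Hc => /= <-; auto.
Qed.

(** * Simple paths in a tree *)

Section Tree.
Set Implicit Arguments.
Unset Strict Implicit.
Context {R : realType} {G : rooted_graph R}.
Implicit Types (x y z : vertex G) (e : edge G) (p q : seq (vertex G)).

Lemma adj_sym x y : adj x y = adj y x.
Proof. by apply/asboolP/asboolP => -[e E]; exists e; rewrite E setUC. Qed.

Lemma adjP {e x y} : ends e = [set x; y] -> adj x y.
Proof. by move=> E; apply/asboolP; exists e. Qed.

Context (tree : is_tree G).

(* Otherwise, after dropping the common beginning, [p] up to its first vertex on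
   [q] followed by [q] backwards is a cycle. *)
Lemma simple_path_uniq x p q :
  simple_path x p -> simple_path x q -> last x p = last x q -> p = q.
Proof.
have cycle_free := tree.2.
elim: p x q => [|a p IH] x [|b q] //.
- by rewrite /simple_path => _ /andP[_ /andP[/= + _]] E; rewrite E mem_last.
- by rewrite /simple_path => /andP[_ /andP[/= + _]] _ E; rewrite -E mem_last.
have [<-|ab] := eqVneq a b.
  rewrite /simple_path /= => /andP[/andP[_ pp] /and3P[_ ap up]].
  move=> /andP[/andP[_ pq] /and3P[_ aq uq]] E; congr (_ :: _).
  by apply: (IH a) => //; rewrite /simple_path /= ?pp ?pq ?ap ?up ?aq ?uq.
move=> /andP[pp up] /andP[pq uq] E; exfalso.
have hasq : has (mem (b :: q)) (a :: p).
  apply/hasP; exists (last a p); first exact: mem_last.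
  by rewrite [last a p]E; exact: (mem_last b q).
have {ab} : head x (a :: p) != head x (b :: q) by [].
move: pp up {E}; case/split_find: hasq => z p1 p2 zq p1q pp up ab.
have : ~~ has (mem p1) (b :: q) by rewrite has_sym.
move: pq uq {p1q}; case/splitPr: zq ab => q1 q2 ab pq uq p1q.
apply: (cycle_free (x :: p1 ++ z :: rev q1)).
  (* As the two paths start with different vertices, [p1] and [q1] are not both empty, so the cycle
     has at least three vertices. *)
  rewrite /= size_cat /= size_rev addnS ltnS.
  case: p1 {pp up p1q} ab => [|? ?]; case: q1 {pq uq} => [|? ?] //=.
  by rewrite eqxx.
move: pp; rewrite cat_path rcons_path => /andP[/andP[pp1 az] _].
move: pq; rewrite -cat_rcons cat_path => /andP[pq1 _].
move: p1q; rewrite has_cat /= !negb_or => /and3P[p1q1 zp1 _].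
rewrite /ucycle /= rcons_cat cat_path /= rcons_path.
apply/andP; split.
  apply/and3P; split => //.
  have := rev_path (@adj R G) x (rcons q1 z).
  rewrite last_rcons belast_rcons rev_cons rcons_path => ->.
  by rewrite (eq_path (e' := @adj R G)) // => u v; exact: adj_sym.
move: up => /=; rewrite cat_uniq mem_cat rcons_uniq mem_rcons in_cons.
rewrite !negb_or => /andP[/andP[/andP[xz xp1] _] /andP[/andP[_ up1] _]].
rewrite -cat_rcons /= cat_uniq mem_cat rcons_uniq mem_rcons in_cons in uq.
move: uq; rewrite !negb_or => /andP[/andP[/andP[_ xq1] _] /andP[/andP[zq1 uq1] _]].
rewrite cat_uniq /= mem_rev rev_uniq mem_cat in_cons mem_rev !negb_or.
by rewrite xz xp1 xq1 up1 zq1 uq1 zp1 has_rev p1q1.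
Qed.

Lemma simple_path_rcons x p y :
  simple_path x (rcons p y) =
  [&& simple_path x p, adj (last x p) y & y \notin x :: p].
Proof.
rewrite /simple_path rcons_path -rcons_cons rcons_uniq.
by case: (path _ _ _); case: (adj _ _); case: (y \notin _); case: (uniq _).
Qed.

Lemma ex_simple_path x y : exists2 p, simple_path x p & last x p = y.
Proof.
have [p [+ <-]] := tree.1 x y; case/shortenP => p' pp' up' _.
by exists p'; rewrite // /simple_path pp' up'.
Qed.

(** * Edges encoded by paths from the root *)

(** Each edge has exactly one root path and is determined by it. The generation is its length, and
    passing to a child appends one vertex. *)
Definition root_path e p : Prop :=
  simple_path (Defs.root G) p /\ path_ends_with e p.

Lemma root_pathP e p : root_path e p ->
  exists q y, [/\ p = rcons q y, simple_path (Defs.root G) q,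
    simple_path (Defs.root G) p & ends e = [set last (Defs.root G) q; y]].
Proof.
move=> [sp [q [y [E1 E2]]]]; exists q, y; split=> //.
by move: sp; rewrite E1 simple_path_rcons => /and3P[].
Qed.

(** Take a simple path from the root to one end [x]. If it avoids the other end [y], append [y];
    otherwise cut it at [y] and append [x]. *)
Lemma ex_root_path e : exists p, root_path e p.
Proof.
have [x [y [xy E]]] := endsP e.
have [p sp px] := ex_simple_path (Defs.root G) x.
have axy := adjP E.
have [yp|yp] := boolP (y \in Defs.root G :: p); last first.
  exists (rcons p y); split; last by exists p, y; rewrite px.
  by rewrite simple_path_rcons sp px axy yp.
case/splitPl: yp sp px => p1 p2 py /andP[pp up] px.
move: pp up; rewrite cat_path => /andP[pp1 _].
rewrite -cat_cons cat_uniq => /and3P[up1 dis up2].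
exists (rcons p1 x); split; last by exists p1, x; split => //; rewrite py setUC.
rewrite simple_path_rcons /simple_path pp1 up1 py adj_sym axy /=.
move: dis px; rewrite last_cat py; case/lastP: p2 up2 => [|p2 x'] _ dis /=.
  by move=> yx; case: xy.
rewrite last_rcons => <-; apply: contra dis => xp.
by apply/hasP; exists x' => //; rewrite mem_rcons mem_head.
Qed.

(** If the paths crossed [e] in opposite directions, each would be the other with its last vertex
    removed, which their lengths forbid. *)
Lemma root_path_uniq e p p' : root_path e p -> root_path e p' -> p = p'.
Proof.
move=> /root_pathP[q [y [-> sq sp E]]] /root_pathP[q' [y' [-> sq' sp' E']]].
move: (E); rewrite E' => /set2_eqP[[l ->]|[l1 l2]].
  by rewrite (simple_path_uniq sq sq').
have H1 : q = rcons q' y' by apply: (simple_path_uniq sq sp'); rewrite last_rcons.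
have H2 : q' = rcons q y by apply: (simple_path_uniq sq' sp); rewrite last_rcons.
move: (congr1 size H1) (congr1 size H2); rewrite !size_rcons => -> /eqP.
by rewrite -addn2 -[X in X == _]addn0 eqn_add2l.
Qed.

Lemma root_path_inj e e' p : root_path e p -> root_path e' p -> e = e'.
Proof.
move=> /root_pathP[q [y [-> _ _ E]]] /root_pathP[q' [y' [+ _ _ E']]].
by move/rcons_inj => [qq yy]; subst; apply: ends_inj; rewrite E E'.
Qed.

Lemma generationE e p : root_path e p -> generation e = size p.
Proof.
move=> ep; rewrite /generation; case: xgetP => [n _ [p' [sp' ep' ->]]|].
  by rewrite (@root_path_uniq e p p').
by move/(_ (size p)); case; exists p; case: ep.
Qed.

(** * Parents and descending paths *)

(** The common vertex is one of two ends of each edge. Simple paths from the root to it coincide,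
    and lengths leave only the case where [p] stops at the last but one vertex of [p']. *)
Lemma parent_root_path e e' p p' : parent e e' ->
  root_path e p -> root_path e' p' ->
  exists2 y, p' = rcons p y & ends e' = [set last (Defs.root G) p; y].
Proof.
move=> [[_ [z [ze ze']]]] + ep ep'.
rewrite (generationE ep) (generationE ep').
case: (root_pathP ep) => [q [y [-> sq sp E]]].
case: (root_pathP ep') => [q' [y' [-> sq' sp' E']]].
rewrite !size_rcons => -[sz].
have Q : rcons q y = q'.
  move: ze ze'; rewrite E E' => -[] /= -> -[] /= zz.
  - by have := simple_path_uniq sq sq' zz => /(congr1 size)/eqP; rewrite sz ltn_eqF.
  - have := simple_path_uniq sq sp'; rewrite last_rcons => /(_ zz).
    by move=> /(congr1 size)/eqP; rewrite size_rcons sz ltn_eqF.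
  - by apply: (simple_path_uniq sp sq'); rewrite last_rcons.
  - have := simple_path_uniq sp sp'; rewrite !last_rcons => /(_ zz).
    by move=> /(congr1 size)/eqP; rewrite !size_rcons sz ltn_eqF.
by exists y'; rewrite Q.
Qed.

Lemma generation_gt0 e : (0 < generation e)%N.
Proof.
have [p ep] := ex_root_path e; rewrite (generationE ep).
by have [q [y [-> _ _ _]]] := root_pathP ep; rewrite size_rcons.
Qed.

Lemma parent_uniq e1 e2 e' : parent e1 e' -> parent e2 e' -> e1 = e2.
Proof.
have [[p1 ep1] [p2 ep2]] := (ex_root_path e1, ex_root_path e2).
have [p' ep'] := ex_root_path e' => par1 par2.
have [y E1 _] := parent_root_path par1 ep1 ep'.
have [y' + _] := parent_root_path par2 ep2 ep'.
by rewrite E1 => /rcons_inj[E _]; rewrite E in ep1; exact: root_path_inj ep1 ep2.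
Qed.

Lemma generation_descending (gamma : nat -> edge G) :
  (forall i, parent (gamma i) (gamma i.+1)) ->
  forall i, generation (gamma i) = (generation (gamma 0%N) + i)%N.
Proof.
by move=> par; elim=> [|i IH]; rewrite ?addn0 // (par i).2 IH addnS.
Qed.

Lemma descending_inj (gamma : nat -> edge G) :
  (forall i, parent (gamma i) (gamma i.+1)) -> injective gamma.
Proof.
move=> par i j /(congr1 (@generation R G)).
by rewrite (generation_descending par i) (generation_descending par j) => /addnI.
Qed.

(** The edges determine the vertices, so a descending path can be handled as a sequence of edges. *)
Lemma Gamma_inftyP (gamma : nat -> edge G) :
  Gamma_infty gamma <->
  S1 (gamma 0%N) /\ forall i, parent (gamma i) (gamma i.+1).
Proof.
split=> [[[v [v0 vinj ve]] par]|[g1 par]]; split=> //.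
  have E : root_path (gamma 0%N) [:: v 1%N].
    split; last by exists [::], (v 1%N); rewrite -v0 -ve.
    rewrite -[[:: _]]/(rcons [::] _) simple_path_rcons /= -v0 (adjP (ve _)).
    by rewrite /simple_path /= inE (inj_eq vinj).
  by rewrite /S1 /= (generationE E).
have [phi ephi] := choice ex_root_path.
(* [P i] is the path from the root to the vertex [v i]. It has length [i], and simple paths with the
   same end agree, so [v] is injective. *)
pose P i := if i is j.+1 then phi (gamma j) else [::].
pose v i := last (Defs.root G) (P i).
have Psize i : size (P i) = i.
  case: i => //= i; rewrite -(generationE (ephi _)) generation_descending //.
  by rewrite g1.
exists v; split=> // [i j vij|i].
  have sP k : simple_path (Defs.root G) (P k) by case: k => //= k; case: (ephi (gamma k)).
  by rewrite -(Psize i) -(Psize j) (simple_path_uniq (sP i) (sP j) vij).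
case: i => [|i]; last first.
  have [y E ->] := parent_root_path (par i) (ephi _) (ephi _).
  by rewrite /v /= E last_rcons.
have := Psize 1%N; rewrite /v /=.
have [q [y [-> _ _ ->]]] := root_pathP (ephi (gamma 0%N)).
by rewrite size_rcons last_rcons => -[/size0nil ->].
Qed.

End Tree.

(** * Sums over disjoint sets and weighted averages *)

(** Split the sum over [E] along [D i]: by disjointness the other sets lie in the remainder of [E],
    where induction applies. *)
Lemma sum_esum_disjoint_le {R : realType} {T : choiceType} {I : eqType}
    (r : seq I) (D : I -> set T) (E : set T) (a : T -> \bar R) :
  uniq r -> (forall x, (0 <= a x)%E) ->
  {in r, forall i, D i `<=` E} ->
  {in r &, forall i j x, D i x -> D j x -> i = j} ->
  (\sum_(i <- r) \esum_(x in D i) a x <= \esum_(x in E) a x)%E.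
Proof.
move=> + a0; elim: r E => [|i r IH] E /=; first by rewrite big_nil esum_ge0.
move=> /andP[ir ur] DE dis; rewrite big_cons [leRHS](esumID (D i)) //.
rewrite (setIidr (DE i _)) ?mem_head //; apply: leeD => //; apply: IH => //.
  move=> j jr x Djx; split; first by apply: (DE j) Djx; rewrite in_cons jr orbT.
  move=> Dix; move: ir; rewrite (dis i j _ _ x) ?mem_head ?jr //.
  by rewrite in_cons jr orbT.
by move=> j k jr kr; apply: dis; rewrite in_cons ?jr ?kr orbT.
Qed.

(* Otherwise multiply the reverse inequality by [h] and sum over the support
   of [eta]; the support is finite because the sum is not [0]. *)
Lemma exists_le_weighted {R : realType} {T : choiceType} (A : set T)
    (eta w : T -> R) (h c : R) :
  (forall x, 0 <= eta x) -> 0 < h -> \sum_(x \in A) eta x = h ->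
  (forall r : seq T, uniq r -> [set` r] `<=` A -> \sum_(x <- r) w x <= c) ->
  exists x, [/\ A x, 0 < eta x & w x * h <= c * eta x].
Proof.
move=> eta0 h0 + wc; case: finite_supportP => [_|X XA _ suppX].
  by rewrite big_nil => E; rewrite -E ltxx in h0.
move=> etaX; apply: contrapT => no_x.
have gt_x x : x \in X -> c * eta x < w x * h.
  move=> xX; have [Ax ex] : (A `&` eta @^-1` [set~ 0]) x by rewrite -suppX.
  rewrite ltNge; apply/negP => le_x; apply: no_x; exists x; split=> //.
  by rewrite lt_neqAle eta0 eq_sym andbT; apply/eqP.
have : \sum_(x <- X) c * eta x < \sum_(x <- X) w x * h.
  rewrite big_seq [ltRHS]big_seq; apply: ltr_sum => //.
  case: (fset_0Vmem X) etaX => [->|[x xX] _].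
    by rewrite big_seq_fset0 => E; rewrite -E ltxx in h0.
  by apply/hasP; exists x.
rewrite -mulr_sumr etaX -mulr_suml ltr_pM2r // ltNge => /negP; apply.
exact: wc.
Qed.

(** * The indicator of a descending path *)

Lemma fsum_indic {R : realType} {T : choiceType} (A B : set T) :
  \sum_(x \in A) ((x \in B)%:R : R) = \sum_(x \in A `&` B) (1 : R).
Proof.
by rewrite fsbig_mkcondr; apply: eq_fsbigr => x _; case: (x \in B).
Qed.

(** The path has one edge in each generation, so it meets [S1] once and the children of each of its
    edges once. An edge off the path has no child on it, since parents are unique and the first edge
    has no parent. *)
Lemma indic_Lambda {R : realType} {G : rooted_graph R} (tree : is_tree G)
    (gamma : nat -> edge G) :
  Gamma_infty gamma -> Lambda (fun e => (e \in range gamma)%:R : R).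
Proof.
move=> /(Gamma_inftyP tree)[g1 par].
have gen i : generation (gamma i) = i.+1.
  by rewrite (generation_descending par) g1.
split=> [e||e].
- exact: ler0n.
- rewrite fsum_indic (_ : _ `&` _ = [set gamma 0%N]) ?fsbig_set1 //.
  apply/seteqP; split=> [e [+ [i _ gi]]|_ ->].
    by rewrite -gi /S1 /= gen => -[->].
  by split=> //; exists 0%N.
rewrite fsum_indic; case: (boolP (e \in range gamma)) => [|/negP nr].
  rewrite inE => -[i _ <-].
  rewrite (_ : _ `&` _ = [set gamma i.+1]) ?fsbig_set1 //.
  apply/seteqP; split=> [e' [[_ +] [j _ gj]]|_ ->].
    by rewrite -gj !gen => -[->].
  by split; [exact: par|exists i.+1].
rewrite (_ : _ `&` _ = set0) ?fsbig_set0 //.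
apply/seteqP; split=> // e' [/= pe [[|j] _ E]].
  by move: (pe.2); rewrite -E gen => -[] /esym/eqP; rewrite (gtn_eqF (generation_gt0 tree e)).
apply: nr; rewrite inE; exists j => //.
by apply: (parent_uniq tree (par j)); rewrite E.
Qed.

(** * Construction of a light descending path *)

Lemma Lambda_light_path {R : realType} {G : rooted_graph R} (tree : is_tree G)
    (rho eta : edge G -> R) (s : R) :
  (forall e, 0 <= rho e) -> Lambda eta ->
  \esum_(e in [set: edge G]) (rho e * eta e)%:E = s%:E ->
  exists2 gamma, Gamma_infty gamma & (path_length rho gamma <= s%:E)%E.
Proof.
move=> rho0 [eta0 etaS1 etac] sE.
have [phi phiP] := choice (ex_root_path tree).
pose a e : \bar R := (rho e * eta e)%:E.
have a0 e : (0 <= a e)%E by rewrite lee_fin mulr_ge0.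
(* In terms of root paths, this is [e] together with its descendants. *)
pose D e := [set f | prefix (phi e) (phi f)].
have W_fin A : \esum_(f in A) a f \is a fin_num.
  have W0 : (0 <= \esum_(f in A) a f)%E by rewrite esum_ge0.
  rewrite ge0_fin_numE // (@le_lt_trans _ _ s%:E) ?ltry // -sE.
  rewrite esum_mkcond; apply: le_esum => f _.
  by case: ifP => // _; exact: a0.
(* This is $W(e)$; the sum is finite because it is at most [s]. *)
pose w e : R := fine (\esum_(f in D e) a f).
have wE e : (w e)%:E = \esum_(f in D e) a f by rewrite fineK.
have w0 e : 0 <= w e by rewrite -lee_fin wE esum_ge0.
have D_disjoint (e e' f : edge G) :
    generation e = generation e' -> D e f -> D e' f -> e = e'.
  rewrite (generationE tree (phiP e)) (generationE tree (phiP e')) /D /=.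
  rewrite !prefixE => -> /eqP E /eqP E'.
  have pe := phiP e; rewrite -E E' in pe.
  exact: (root_path_inj pe (phiP e')).
have w_sum (r : seq (edge G)) (E : set (edge G)) c : uniq r ->
    {in r, forall e, D e `<=` E} ->
    {in r &, forall e e', generation e = generation e'} ->
    \esum_(f in E) a f = c%:E -> \sum_(e <- r) w e <= c.
  move=> ur rE rgen Ec; rewrite -lee_fin -Ec -sumEFin.
  under eq_bigr do rewrite wE.
  apply: sum_esum_disjoint_le => // e e' er er' f; apply: D_disjoint.
  exact: rgen.
have [e1 [e1S eta1 we1]] : exists e, [/\ S1 e, 0 < eta e & w e * 1 <= s * eta e].
  apply: exists_le_weighted => // r ur rS; apply: (@w_sum _ [set: edge G]) => //.
  by move=> e e' /rS -> /rS ->.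
have /choice[next nextP] e : exists e', 0 < eta e ->
    [/\ children e e', 0 < eta e' &
        w e' * eta e <= (w e - rho e * eta e) * eta e'].
  (* Where [eta e] is not positive the value of [next] is arbitrary; the path never reaches such an
     edge. *)
  have [eta_e|_] := boolP (0 < eta e); last by exists e.
  suff [e' ?] : exists e', [/\ children e e', 0 < eta e' &
        w e' * eta e <= (w e - rho e * eta e) * eta e'] by exists e'.
  apply: exists_le_weighted => // r ur rc.
  (* The descendants of the children lie in [D e] without [e], and removing [e] lowers the sum by
     [rho e * eta e]. *)
  apply: (@w_sum _ (D e `\ e)) => //.
  - move=> e' /rc pe f; rewrite /D /= => pf.
    have [y Ey _] := parent_root_path tree pe (phiP e) (phiP e').
    split; first by apply: prefix_trans pf; rewrite Ey prefix_rcons.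
    move=> fe; move: pf; rewrite fe Ey => /size_prefix.
    by rewrite size_rcons ltnn.
  - by move=> e' e'' /rc[_ ->] /rc[_ ->].
  rewrite EFinB wE [X in (X - _)%E](esumID [set e]) //.
  rewrite (setIidr _); last by move=> _ ->; exact: prefix_refl.
  by rewrite esum_set1 // addeC addeK // setDE.
pose gamma i := iter i next e1.
have eta_gamma i : 0 < eta (gamma i).
  by elim: i => //= i IH; case: (nextP _ IH).
have par i : parent (gamma i) (gamma i.+1).
  by have [pe _ _] := nextP _ (eta_gamma i).
exists gamma; first exact/(Gamma_inftyP tree).
(* Invariant: the length of the first [n] edges plus the ratio $W/\eta$ at the next edge is at most
   [s]. *)
have partial n :
    \sum_(0 <= i < n) rho (gamma i) + w (gamma n) / eta (gamma n) <= s.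
  elim: n => [|n]; first by rewrite big_nil add0r ler_pdivrMr // -[w _]mulr1.
  apply: le_trans; rewrite big_nat_recr //= -addrA lerD2l.
  have [_ eta_next w_next] := nextP _ (eta_gamma n).
  have : w (gamma n.+1) / eta (gamma n.+1) <=
      (w (gamma n) - rho (gamma n) * eta (gamma n)) / eta (gamma n).
    by rewrite ler_pdivrMr // mulrAC ler_pdivlMr.
  by rewrite mulrBl mulfK ?gt_eqF // lerBrDl.
(* As [gamma] is injective, its length is a series; the ratios are nonnegative, so [s] bounds the
   partial sums. *)
rewrite /path_length (esum_image setT gamma) //; last first.
  by move=> i j _ _; exact: (descending_inj par).
rewrite -nneseries_esumT; last by move=> n; rewrite lee_fin.
apply: lime_le; first by apply: is_cvg_nneseries => n _ _; rewrite lee_fin.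
apply: nearW => n; rewrite sumEFin lee_fin; apply: le_trans (partial n).
by rewrite lerDl divr_ge0.
Qed.

(** * Admissibility tested on [Lambda] *)

Theorem theorem5 (R : realType) (G : rooted_graph R) (rho : edge G -> R)
    (HG : proper_infinite_tree G) (Hrho : forall e : edge G, 0 <= rho e) :
  Adm (Gamma_infty (G := G)) rho <->
  (forall eta : edge G -> R, Lambda (G := G) eta ->
     (1 <= \esum_(e in [set: edge G]) (rho e * eta e)%:E)%E).
Proof.
have [tree _ _ _] := HG.
split=> [[_ adm] eta Leta|H].
  have eta0 e : 0 <= eta e by case: Leta.
  rewrite leNgt; apply/negP => lt1.
  have W0 : (0 <= \esum_(e in [set: edge G]) (rho e * eta e)%:E)%E.
    by rewrite esum_ge0 // => e _; rewrite lee_fin mulr_ge0.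
  (* A total below 1 is finite, so it can serve as the real [s]; the path obtained is then shorter
     than 1. *)
  have [|gamma Ggamma le_s] := @Lambda_light_path _ _ tree rho eta
      (fine (\esum_(e in [set: edge G]) (rho e * eta e)%:E)) Hrho Leta.
    by rewrite fineK // ge0_fin_numE // (lt_trans lt1) // ltry.
  move: le_s; rewrite fineK; last by rewrite ge0_fin_numE // (lt_trans lt1) // ltry.
  by rewrite leNgt (lt_le_trans lt1) ?adm.
split=> // gamma Ggamma; apply: le_trans (H _ (indic_Lambda tree Ggamma)) _.
rewrite /path_length [leRHS]esum_mkcond; apply: le_esum => e _.
by case: ifP => _; rewrite ?mulr1 ?mulr0.
Qed.
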